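(* Let $r\ge 2$. For every $\varepsilon>0$ there exist $n_0=n_0(\varepsilon)$ and $\delta=\delta(\varepsilon)>0$ such that for all $n>n_0$ and all integers $m\le\binom{n}{2}$ with $m>t_r(n)-\delta n^2$, $$\Delta_r(n,m)>(1-\varepsilon)\frac{2rm}{n}.$$
   Context: Graphs are finite and simple; $d(u)$ is the degree of vertex $u$. For a graph $G$ and $r\ge 2$, $\Delta_r(G)=\max\{\sum_{u\in R} d(u): R \text{ is the vertex set of an } r\text{-clique of } G\}$, with $\Delta_r(G)=0$ if $G$ has no $r$-clique. $\Delta_r(n,m)$ is the minimum of $\Delta_r(G)$ over all graphs $G$ with $n$ vertices and $m$ edges. $t_r(n)$ is the number of edges of the $r$-partite Turán graph on $n$ vertices (complete $r$-partite graph with part sizes differing by at most one). *)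

(* Defs.v *)
From mathcomp Require Import all_boot.

Set Implicit Arguments.
Unset Strict Implicit.
Unset Printing Implicit Defensive.

(* A simple graph on the finite vertex type T is given by its set of edges,    *)
(* each edge being a set of two vertices.                                     *)
Definition simple_graph (T : finType) (E : {set {set T}}) : bool :=
  [forall f in E, #|f| == 2].

(* No test u != v is needed: [set u; u] is not an edge of a simple graph.     *)
Definition adjacent (T : finType) (E : {set {set T}}) (u v : T) : bool :=
  [set u; v] \in E.

Definition degree (T : finType) (E : {set {set T}}) (u : T) : nat :=
  #|[set v | adjacent E u v]|.

Definition clique (T : finType) (E : {set {set T}}) (R : {set T}) : bool :=
  [forall u in R, forall v in R, (u != v) ==> adjacent E u v].

(* \max over an empty range is 0, the convention for graphs without r-clique. *)
Definition Delta (T : finType) (r : nat) (E : {set {set T}}) : nat :=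
  \max_(R : {set T} | (#|R| == r) && clique E R) \sum_(u in R) degree E u.

(* The minimum of Delta r over the graphs with n vertices, here 'I_n, and m   *)
(* edges. The seed set0 of [arg min] only matters when there is no such graph,*)
(* i.e. when 'C(n, 2) < m: see Delta_minP.                                    *)
Definition Delta_min (r n m : nat) : nat :=
  Delta r [arg min_(E < (set0 : {set {set 'I_n}})
                    | simple_graph E && (#|E| == m)) Delta r E].

(* The parts are the residue classes modulo r, which are balanced on 'I_n.    *)
Definition turan_graph (r n : nat) : {set {set 'I_n}} :=
  [set [set p.1; p.2] | p : 'I_n * 'I_n & p.1 != p.2 %[mod r]].

Definition turan_number (r n : nat) : nat := #|turan_graph r n|.

Lemma turan_graph_simple (r n : nat) : simple_graph (turan_graph r n).
Proof.
apply/forall_inP => f /imsetP[[i j]]; rewrite inE /= => nij ->.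
by rewrite cards2; case: (eqVneq i j) nij => [->|//]; rewrite eqxx.
Qed.

Lemma Delta_minP (r n m : nat) : m <= 'C(n, 2) ->
  (exists2 E : {set {set 'I_n}},
     simple_graph E && (#|E| == m) & Delta r E = Delta_min r n m) /\
  (forall E : {set {set 'I_n}}, simple_graph E -> #|E| = m ->
     Delta_min r n m <= Delta r E).
Proof.
rewrite -[n in 'C(n, 2)]card_ord -cardsT -cards_draws.
set D := [set A | _] => /card_geqP[s [us szs sD]].
pose E0 := [set f in s].
have PE0 : simple_graph E0 && (#|E0| == m).
  apply/andP; split; last by rewrite cardsE (card_uniqP us) szs.
  by apply/forall_inP => f; rewrite inE => /sD; rewrite inE => /andP[].
rewrite /Delta_min /arg_min /extremum; case: pickP => [E|noE] /=.
  move=> /andP[PE /forall_inP minE]; split; first by exists E.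
  by move=> F sF cF; apply: minE; rewrite sF cF eqxx.
have [E PE minE] := @arg_minnP _ E0
  (fun E : {set {set 'I_n}} => simple_graph E && (#|E| == m)) (Delta r) PE0.
by have /negP[] := noE E; rewrite /= PE; apply/forall_inP.
Qed.

(* Main.v *)
(* Pick vertices v_1, v_2, ... greedily: v_i has maximum degree d_i in the     *)
(* common neighbourhood A_i of its predecessors. Put b_i = |A_i \ N(v_i)| for  *)
(* i < r and b_r = |A_r|. The b_i sum to n, all degrees in the i-th part are at *)
(* most d_i, and d_i <= n - b_i for i < r, so 2m <= \sum_i b_i d_i. Writing     *)
(* e_i = n - b_i - d_i, this says that                                          *)
(*   \sum_i ((b_i - n/r)^2 + b_i e_i) <= n^2 - n^2/r - 2m,                      *)
(* which is at most eta n^2 when m is close to the Turan number. If all e_i are *)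
(* nonnegative, then every b_i is about n/r and \sum_i d_i = (r-1)n - \sum_i e_i *)
(* is nearly (r-1)n >= 2rm/n. If only e_r is negative, then either              *)
(* \sum_i d_i >= (r-1)n, and Cauchy-Schwarz gives \sum_i d_i >= 2rm/n, or some   *)
(* weight b_r can be moved to the other parts, where degrees are larger, until  *)
(* e_r = 0. The same inequality rules out b_r = 0, so v_1, ..., v_r exist.      *)
Require Import Defs.
From mathcomp Require Import all_boot all_order all_algebra.
From mathcomp Require Import reals.
From mathcomp Require Import ring lra.

Set Implicit Arguments.
Unset Strict Implicit.
Unset Printing Implicit Defensive.

Import Order.TTheory GRing.Theory Num.Theory.

(** With r = p+1 the greedy indices run over 0, ..., p, and [ord_max] is the exceptional last part.
    The graph enters only through [Delta_ge], which turns the greedy choice into real weights b and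
    degrees d; all else is the inequality [degree_sum_ge] about such weights. The identity
    [sum_slack] underlies its cases: [degree_sum_ge_slack] when every e_i is nonnegative, and
    shifting weight to reach that situation. [degree_sum_ge_big] handles a large degree sum without
    it. [last_part_neq0] guarantees that the greedy choice does not stop early. *)

Lemma sum_degree (T : finType) (E : {set {set T}}) :
  simple_graph E -> \sum_u degree E u = 2 * #|E|.
Proof.
move=> /forall_inP sE.
have deg_inc u : degree E u = #|[set f in E | u \in f]|.
  rewrite /degree -(@card_in_imset _ _ (fun v => [set u; v])); last first.
    move=> v w; rewrite !inE => /sE; rewrite cards2; case: (eqVneq u v) => //= uv _ _.
    by move=> /setP/(_ v); rewrite !inE eqxx orbT (eq_sym v u) (negPf uv) => /esym/eqP.
  apply: eq_card => f; rewrite inE; apply/imsetP/andP => [[v]|[fE uf]].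
    by rewrite inE => uv ->; rewrite !inE eqxx.
  have /cards2P[v [w [_ fvw]]] := sE f fE.
  have [z fz] : exists z, f = [set u; z].
    move: uf; rewrite fvw !inE => /orP[]/eqP->; first by exists w.
    by exists v; rewrite setUC.
  by exists z; rewrite ?inE /adjacent -?fz.
under eq_bigr => u _ do rewrite deg_inc -sum1dep_card big_mkcondr.
rewrite exchange_big /= mulnC -sum_nat_const; apply: eq_bigr => f fE.
by rewrite -big_mkcond /= sum1_card; apply/eqP/sE.
Qed.

(** * The greedy clique and its parts *)

Section Greedy.
Variables (T : finType) (E : {set {set T}}) (x0 : T).

Definition max_degree_vertex (A : {set T}) : T :=
  if [pick u in A] is Some u then [arg max_(v > u in A) degree E v] else x0.

Lemma max_degree_vertexP (A : {set T}) u : u \in A ->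
  max_degree_vertex A \in A /\ degree E u <= degree E (max_degree_vertex A).
Proof.
rewrite /max_degree_vertex => uA; case: pickP => [v vA|/(_ u)]; last by rewrite uA.
by case: arg_maxnP => // w wA /(_ u uA).
Qed.

Fixpoint greedy_rest i : {set T} :=
  if i is j.+1 then
    greedy_rest j :&: [set v | adjacent E (max_degree_vertex (greedy_rest j)) v]
  else setT.

Definition greedy_vertex i := max_degree_vertex (greedy_rest i).

Lemma greedy_restS i :
  greedy_rest i.+1 = greedy_rest i :&: [set v | adjacent E (greedy_vertex i) v].
Proof. by []. Qed.

Lemma greedy_rest_sub i j : i <= j -> greedy_rest j \subset greedy_rest i.
Proof.
move=> /subnK<-; elim: (j - i) => // k; apply: subset_trans.
by rewrite addSn greedy_restS subsetIl.
Qed.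

Definition greedy_part i := greedy_rest i :\: greedy_rest i.+1.

(** A vertex leaves the rest at stage i exactly by not being a neighbour of the chosen vertex. *)
Lemma card_greedy_part i :
  #|greedy_part i| + degree E (greedy_vertex i) <= #|T|.
Proof.
rewrite -(cardsC [set v | adjacent E (greedy_vertex i) v]) addnC leq_add2l.
apply: subset_leq_card; apply/subsetP => u.
by rewrite in_setD greedy_restS !inE; case: (u \in _); rewrite ?andbF ?andbT.
Qed.

Lemma sum_degree_rest i : \sum_(u in greedy_rest i) degree E u <=
  #|greedy_rest i| * degree E (greedy_vertex i).
Proof.
rewrite -sum_nat_const; apply: leq_sum => u uA.
by have [] := max_degree_vertexP uA.
Qed.

Lemma sum_degree_part i : \sum_(u in greedy_part i) degree E u <=
  #|greedy_part i| * degree E (greedy_vertex i).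
Proof.
rewrite -sum_nat_const; apply: leq_sum => u /setDP[uA _].
by have [] := max_degree_vertexP uA.
Qed.

Lemma sum_greedy_rest (F : T -> nat) i :
  \sum_(u in greedy_rest i) F u =
  \sum_(u in greedy_part i) F u + \sum_(u in greedy_rest i.+1) F u.
Proof.
rewrite (big_setID (greedy_rest i.+1)) /= addnC; congr (_ + _).
by rewrite (setIidPr (greedy_rest_sub (leqnSn i))).
Qed.

Lemma sum_greedy (F : T -> nat) p : \sum_u F u =
  \sum_(i < p) \sum_(u in greedy_part i) F u + \sum_(u in greedy_rest p) F u.
Proof.
elim: p => [|p IH]; first by rewrite big_ord0; apply: eq_bigl => u; rewrite inE.
by rewrite IH sum_greedy_rest addnA big_ord_recr.
Qed.

Lemma greedy_vertex_in i : greedy_rest i != set0 -> greedy_vertex i \in greedy_rest i.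
Proof. by move=> /set0Pn[u /max_degree_vertexP[]]. Qed.

Lemma greedy_vertex_adj i j : i < j -> greedy_rest j != set0 ->
  adjacent E (greedy_vertex i) (greedy_vertex j).
Proof.
move=> ij /greedy_vertex_in/(subsetP (greedy_rest_sub ij)).
by rewrite greedy_restS !inE => /andP[].
Qed.

Lemma greedy_degree i j : i <= j -> greedy_rest j != set0 ->
  degree E (greedy_vertex j) <= degree E (greedy_vertex i).
Proof.
move=> ij /greedy_vertex_in/(subsetP (greedy_rest_sub ij)).
by move=> /max_degree_vertexP[].
Qed.

Lemma adjacentC u v : adjacent E u v = adjacent E v u.
Proof. by rewrite /adjacent setUC. Qed.

(** Each chosen vertex lies in the common neighbourhood of the earlier ones. Adjacency already
    forces distinctness, since a loop would be an edge of size 1. *)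
Lemma sum_greedy_le_Delta p : simple_graph E -> greedy_rest p != set0 ->
  \sum_(i < p.+1) degree E (greedy_vertex i) <= Delta p.+1 E.
Proof.
move=> /forall_inP sE Rp.
have R_ne (i : 'I_p.+1) : greedy_rest i != set0.
  apply: contraNneq Rp => Ri; have := greedy_rest_sub (leq_ord i).
  by rewrite Ri subset0.
have adj (i j : 'I_p.+1) : i != j -> adjacent E (greedy_vertex i) (greedy_vertex j).
  rewrite -val_eqE neq_ltn => /orP[] ij; first exact: greedy_vertex_adj.
  by rewrite adjacentC greedy_vertex_adj.
have vinj : injective (fun i : 'I_p.+1 => greedy_vertex i).
  move=> i j vij; apply/eqP; apply: contraT => /adj/sE.
  by rewrite vij setUid cards1.
set D := [set greedy_vertex i | i : 'I_p.+1].
have -> : \sum_(i < p.+1) degree E (greedy_vertex i) = \sum_(u in D) degree E u.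
  by rewrite big_imset //; apply: in2W.
apply: (@leq_bigmax_cond _ _ (fun A : {set T} => \sum_(u in A) degree E u) D).
rewrite card_imset // card_ord eqxx /=.
apply/forall_inP => _ /imsetP[i _ ->]; apply/forall_inP => _ /imsetP[j _ ->].
by apply/implyP; rewrite (inj_eq vinj); apply: adj.
Qed.
End Greedy.

(** * A lower bound for the Turán number *)

Lemma card_residue_class r n c :
  #|[set v : 'I_n | v == c %[mod r]]| <= (n %/ r).+1.
Proof.
have h (v : 'I_n) : v %/ r < (n %/ r).+1 by rewrite ltnS leq_div2r // ltnW.
rewrite -[leqRHS]card_ord -cardsT.
rewrite -(@card_in_imset _ _ (fun v => Ordinal (h v))); first exact: subset_leq_card (subsetT _).
move=> u v; rewrite !inE => /eqP uc /eqP vc [uv]; apply: val_inj => /=.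
by rewrite (divn_eq u r) (divn_eq v r) uv uc vc.
Qed.

Lemma degree_turan r n (u : 'I_n) :
  degree (turan_graph r n) u = #|[set v : 'I_n | u != v %[mod r]]|.
Proof.
congr #|pred_of_set _|; apply/setP => v; rewrite !inE.
apply/imsetP/idP => [[[a b]]|uv]; last by exists (u, v); rewrite ?inE.
rewrite inE /= => ab /setP uv.
have := uv a; have := uv b; rewrite !inE !eqxx orbT /=.
move=> /orP[]/eqP eb /orP[]/eqP ea; move: ab; rewrite ea eb ?eqxx //.
by rewrite eq_sym.
Qed.

Lemma degree_turan_ge r n (u : 'I_n) :
  n <= degree (turan_graph r n) u + (n %/ r).+1.
Proof.
rewrite degree_turan -[leqLHS]card_ord -(cardsC [set v : 'I_n | u != v %[mod r]]).
rewrite leq_add2l; apply: leq_trans (card_residue_class r n u).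
apply: subset_leq_card; apply/subsetP => v.
by rewrite !inE negbK eq_sym.
Qed.

(** Summing the minimum degree bound avoids an exact formula; compared with n^2/r the rounding costs
    at most n. *)
Lemma turan_number_ge r n :
  n * n <= 2 * turan_number r n + n * (n %/ r).+1.
Proof.
have const j : n * j = \sum_(u : 'I_n) j by rewrite sum_nat_const card_ord.
rewrite -(sum_degree (turan_graph_simple r n)) !const -big_split.
by apply: leq_sum => u _; apply: degree_turan_ge.
Qed.

(** * The inequality for weights and degrees *)

Local Open Scope ring_scope.

Section WeightedDegrees.
Variables (R : realFieldType) (I : finType).
Implicit Types (b d f : I -> R) (N M eta : R).

Let c : R := #|I|%:R.

Lemma sum_sqr_dev f x : 0 < c -> \sum_i f i = c * x ->
  \sum_i (f i - x) ^+ 2 = \sum_i f i ^+ 2 - c * x ^+ 2.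
Proof.
move=> c0 sf.
have -> : \sum_i (f i - x) ^+ 2 = \sum_i (f i ^+ 2 + ((-2 * x) * f i + x ^+ 2)).
  by apply: eq_bigr => i _; ring.
by rewrite !big_split /= -mulr_sumr sf sumr_const -mulr_natl -/c; ring.
Qed.

Lemma mean_sqr_le f x : 0 < c -> \sum_i f i = c * x ->
  c * x ^+ 2 <= \sum_i f i ^+ 2.
Proof.
move=> c0 sf; rewrite -subr_ge0 -sum_sqr_dev //.
by apply: sumr_ge0 => i _; apply: sqr_ge0.
Qed.

(** Here x is the ideal part size; the subtracted terms measure imbalance of the parts and missing
    degree. *)
Lemma sum_slack b d N x : 0 < c -> N = c * x -> \sum_i b i = N ->
  \sum_i b i * d i = N ^+ 2 - c * x ^+ 2
    - \sum_i ((b i - x) ^+ 2 + b i * (N - b i - d i)).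
Proof.
move=> c0 Nx sb; rewrite big_split /= sum_sqr_dev ?sb //.
have -> : \sum_i b i * (N - b i - d i)
   = \sum_i (N * b i + (- 1 * (b i ^+ 2) + -1 * (b i * d i))).
  by apply: eq_bigr => i _; ring.
by rewrite !big_split /= -!mulr_sumr sb; ring.
Qed.

Section LastPart.
Variables (k : I) (b d : I -> R) (N M eta : R).
Hypothesis c_ge2 : 2 <= c.
Hypothesis N_gt0 : 0 < N.
Hypothesis eta_ge0 : 0 <= eta.
Hypothesis eta_lt : 4 * eta * c ^+ 2 <= 1.
Hypothesis sum_b : \sum_i b i = N.
Hypothesis M_le : M <= \sum_i b i * d i.
Hypothesis M_ge : N ^+ 2 - N ^+ 2 / c - eta * N ^+ 2 <= M.

Let x := N / c.
Let c_gt0 : 0 < c. Proof. by apply: lt_le_trans c_ge2. Qed.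
Let N_x : N = c * x. Proof. by rewrite /x mulrC divfK ?gt_eqF. Qed.
Let x_gt0 : 0 < x. Proof. by rewrite divr_gt0. Qed.
Let eta_N : 4 * (eta * N ^+ 2) <= x ^+ 2.
Proof.
rewrite N_x exprMn.
have -> : 4 * (eta * (c ^+ 2 * x ^+ 2)) = (4 * eta * c ^+ 2) * x ^+ 2 by ring.
by rewrite ler_piMl ?sqr_ge0.
Qed.
Let N_c : N ^+ 2 / c = c * x ^+ 2.
Proof. by rewrite expr2 -mulrA -/x {1}N_x; ring. Qed.

Lemma slack_le :
  \sum_i ((b i - x) ^+ 2 + b i * (N - b i - d i)) <= eta * N ^+ 2.
Proof.
by move: M_le M_ge; rewrite (sum_slack d c_gt0 N_x sum_b) N_c; lra.
Qed.

(** An empty part k would alone contribute x^2 to the slack, four times what [slack_le] can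
    allow. *)
Lemma last_part_neq0 : (forall i, 0 <= b i) ->
  (forall i, i != k -> d i <= N - b i) -> b k != 0.
Proof.
move=> b0 db; apply/eqP => bk; have := slack_le.
rewrite (bigD1 k) //= bk mul0r addr0 sub0r sqrrN.
suff /le_trans h : 0 <= \sum_(i | i != k) ((b i - x) ^+ 2 + b i * (N - b i - d i)).
  move: eta_N; have : 0 < x ^+ 2 by rewrite exprn_gt0.
  by move: (h _ (lexx _)); lra.
apply: sumr_ge0 => i ik; rewrite addr_ge0 ?sqr_ge0 // mulr_ge0 //.
by rewrite subr_ge0 db.
Qed.

Lemma degree_sum_ge_slack : (forall i, 0 <= b i) ->
  (forall i, d i <= N - b i) -> c * ((1 - 8 * eta) * M) <= (\sum_i d i) * N.
Proof.
move=> b0 db; have e0 i : 0 <= N - b i - d i by rewrite subr_ge0.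
have sl := slack_le.
have be0 i : 0 <= b i * (N - b i - d i) by rewrite mulr_ge0.
(* Otherwise the square of [b i - x] would exceed x^2/4, which is at least [eta * N ^+ 2]. *)
have bx i : x / 2 <= b i.
  have : (b i - x) ^+ 2 <= eta * N ^+ 2.
    apply: le_trans sl; rewrite (bigD1 i) //=.
    have : 0 <= \sum_(j | j != i) ((b j - x) ^+ 2 + b j * (N - b j - d j)).
      by apply: sumr_ge0 => j _; rewrite addr_ge0 ?sqr_ge0.
    by move: (be0 i); lra.
  move: eta_N x_gt0 => hN hx hs.
  rewrite leNgt; apply/negP => lt; nra.
have M1 : M <= N ^+ 2 - c * x ^+ 2.
  apply: le_trans M_le _; rewrite (sum_slack d c_gt0 N_x sum_b) lerBlDr lerDl.
  by apply: sumr_ge0 => i _; rewrite addr_ge0 ?sqr_ge0.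
have sumd : \sum_i d i = (c - 1) * N - \sum_i (N - b i - d i).
  rewrite !sumrB sumr_const -mulr_natl -/c sum_b; ring.
(* As every weight is at least x/2, small weighted slack forces small total slack. *)
have sle : x / 2 * \sum_i (N - b i - d i) <= eta * N ^+ 2.
  apply: le_trans sl; rewrite mulr_sumr; apply: ler_sum => i _.
  by apply: ler_wpDl; rewrite ?sqr_ge0 // ler_wpM2r.
rewrite sumd; set e := \sum_i _ in sle *.
have M2 : N ^+ 2 <= 4 * M.
  move: M_ge eta_N; rewrite N_c N_x; have := sqr_ge0 x; have := c_ge2; nra.
have : e * N <= c * (2 * (eta * N ^+ 2)).
  rewrite {1}N_x; have -> : e * (c * x) = c * (2 * (x / 2 * e)) by field.
  by rewrite ler_pM2l // ler_pM2l.
have : c * (2 * (eta * N ^+ 2)) <= c * (8 * eta * M).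
  rewrite ler_pM2l //; have := ler_wpM2l eta_ge0 M2; lra.
have : c * M <= (c - 1) * N * N.
  have -> : (c - 1) * N * N = c * (N ^+ 2 - c * x ^+ 2) by rewrite N_x; ring.
  by rewrite ler_pM2l.
lra.
Qed.

End LastPart.

(** Measuring degrees from d_k removes the uncontrolled weight b_k and lets each other b_i be
    replaced by N - d_i. The mean y of the degrees then enters twice: the sum of squares is at least
    c y^2, and d_k <= y is multiplied by S - (c-1)N, nonnegative by hypothesis. What remains is M <=
    y N. *)
Lemma degree_sum_ge_big (k : I) b d N M : 0 < c ->
  \sum_i b i = N -> M <= \sum_i b i * d i ->
  (forall i, d k <= d i) -> (forall i, i != k -> d i <= N - b i) ->
  (c - 1) * N <= \sum_i d i -> c * M <= (\sum_i d i) * N.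
Proof.
move=> c0 sb Mle dk db bigS; set S := \sum_i d i.
pose y := S / c; have Sy : S = c * y by rewrite /y mulrC divfK ?gt_eqF.
have dky : d k <= y.
  rewrite -(ler_pM2l c0) -Sy /c mulr_natl -sumr_const.
  by apply: ler_sum.
have le1 : \sum_i b i * d i <= \sum_i ((N - d i) * (d i - d k)) + N * d k.
  have -> : \sum_i b i * d i = \sum_i (b i * (d i - d k)) + N * d k.
    rewrite -sb mulr_suml -big_split /=; apply: eq_bigr => i _; ring.
  rewrite lerD2r; apply: ler_sum => i _.
  have [->|ik] := eqVneq i k; first by rewrite subrr !mulr0.
  by rewrite ler_wpM2r ?subr_ge0 // lerBrDr addrC -lerBrDr db.
have eq2 : \sum_i ((N - d i) * (d i - d k)) =
    (N + d k) * S - \sum_i d i ^+ 2 - c * (N * d k).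
  have -> : \sum_i ((N - d i) * (d i - d k)) =
     \sum_i ((N + d k) * d i + (-1 * d i ^+ 2 + - (N * d k))).
    by apply: eq_bigr => i _; ring.
  by rewrite !big_split /= -!mulr_sumr -/S sumr_const -mulr_natl -/c; ring.
have sq : c * y ^+ 2 <= \sum_i d i ^+ 2 by apply: mean_sqr_le.
have le3 : d k * (S - (c - 1) * N) <= y * (S - (c - 1) * N).
  by rewrite ler_wpM2r // subr_ge0.
have : M <= y * N by move: Mle le1 sq le3; rewrite eq2 Sy; lra.
by move=> /(ler_wpM2l (ltW c0)); rewrite Sy mulrA.
Qed.

Lemma degree_sum_ge (k : I) b d N M eta :
  2 <= c -> 0 < N -> 0 <= eta -> 4 * eta * c ^+ 2 <= 1 -> 0 <= M ->
  (forall i, 0 <= b i) -> \sum_i b i = N -> M <= \sum_i b i * d i ->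
  N ^+ 2 - N ^+ 2 / c - eta * N ^+ 2 <= M ->
  (forall i, d k <= d i) -> (forall i, i != k -> d i <= N - b i) -> d k <= N ->
  c * ((1 - 8 * eta) * M) <= (\sum_i d i) * N.
Proof.
move=> c2 N0 eta0 etac M0 b0 sb Mle Mge dk db dkN.
have c0 : 0 < c by apply: lt_le_trans c2.
have [bigS|smallS] := leP ((c - 1) * N) (\sum_i d i).
  apply: le_trans (degree_sum_ge_big c0 sb Mle dk db bigS).
  by rewrite ler_pM2l // ler_piMl // gerBl mulr_ge0.
have [dkb|bdk] := leP (d k) (N - b k).
  apply: (@degree_sum_ge_slack b d N M eta) => // i.
  by have [->//|/db] := eqVneq i k.
pose E := \sum_(i | i != k) (N - b i - d i).
have EE : E + (N - b k - d k) = (c - 1) * N - \sum_i d i.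
  have -> : E + (N - b k - d k) = \sum_i (N - b i - d i).
    by rewrite [RHS](bigD1 k) //= addrC.
  by rewrite !sumrB sumr_const -mulr_natl -/c sb; ring.
have E0 : 0 < E by lra.
(* Moving the fraction t of the slack e_i into each part i != k makes e_k = 0. *)
pose t := (b k + d k - N) / E.
have t0 : 0 <= t by rewrite divr_ge0 ?(ltW E0) //; lra.
(* By [smallS] the total slack, with the negative e_k included, is still positive. *)
have t1 : t <= 1 by rewrite ler_pdivrMr //; lra.
have tE : t * E = b k + d k - N by rewrite divfK ?gt_eqF.
pose b' i := if i == k then N - d k else b i + t * (N - b i - d i).
have b'_ne i : i != k -> b' i = b i + t * (N - b i - d i).
  by rewrite /b' => /negPf->.
have b'_k : b' k = N - d k by rewrite /b' eqxx.
have e0 i : i != k -> 0 <= N - b i - d i by move=> /db; rewrite subr_ge0.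
apply: (@degree_sum_ge_slack b' d N M eta) => //.
- rewrite (bigD1 k) //= b'_k (eq_bigr _ b'_ne) big_split /= -mulr_sumr -/E tE.
  by move: sb; rewrite (bigD1 k) //=; lra.
(* Weight leaves k, where the degree is minimal, so the weighted sum cannot drop. *)
- apply: le_trans Mle _; rewrite (bigD1 k) //= [leRHS](bigD1 k) //= b'_k.
  have -> : \sum_(i | i != k) b' i * d i = \sum_(i | i != k) b i * d i +
      \sum_(i | i != k) t * (N - b i - d i) * d i.
    by rewrite -big_split; apply: eq_bigr => i /b'_ne->; rewrite mulrDl.
  suff : (b k + d k - N) * d k <= \sum_(i | i != k) t * (N - b i - d i) * d i.
    by lra.
  rewrite -tE mulr_sumr mulr_suml; apply: ler_sum => i ik.
  by rewrite ler_wpM2l // mulr_ge0 // e0.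
- move=> i; have [->|ik] := eqVneq i k; first by rewrite b'_k subr_ge0.
  by rewrite b'_ne // addr_ge0 // mulr_ge0 // e0.
- move=> i; have [->|ik] := eqVneq i k; first by rewrite b'_k; lra.
  by rewrite b'_ne //; have := ler_wpM2r (e0 i ik) t1; lra.
Qed.

End WeightedDegrees.

(** * From the inequality to graphs *)

Lemma Delta_ge (R : realFieldType) (T : finType) (E : {set {set T}}) (p : nat)
    (eta : R) (N := #|T|%:R : R) :
  simple_graph E -> (0 < p)%N -> (0 < #|T|)%N ->
  0 <= eta -> 4 * eta * p.+1%:R ^+ 2 <= 1 ->
  N ^+ 2 - N ^+ 2 / p.+1%:R - eta * N ^+ 2 <= (2 * #|E|)%:R ->
  p.+1%:R * ((1 - 8 * eta) * (2 * #|E|)%:R) <= (Delta p.+1 E)%:R * N.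
Proof.
move=> sE p0 T0 eta0 etap Mge.
have [x0 _] : exists x0 : T, x0 \in T by apply/card_gt0P.
pose v := greedy_vertex E x0; pose rest := greedy_rest E x0.
(* Giving the last index all of [rest p] makes the weights sum to N; the price is that [db] excludes
   [ord_max]. *)
pose b (i : 'I_p.+1) : nat :=
  if i == ord_max then #|rest p| else #|greedy_part E x0 i|.
pose br i : R := (b i)%:R; pose d (i : 'I_p.+1) : R := (degree E (v i))%:R.
have b_lt (i : 'I_p) : b (widen_ord (leqnSn p) i) = #|greedy_part E x0 i|.
  by rewrite /b -val_eqE /= ltn_eqF.
have b_max : b ord_max = #|rest p| by rewrite /b eqxx.
have br0 i : 0 <= br i by apply: ler0n.
have sb : \sum_i br i = N.
  rewrite /br -natr_sum big_ord_recr /= b_max /N.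
  have := sum_greedy E x0 (fun=> 1)%N p.
  rewrite !sum1_card => ->; congr (_ + _)%:R.
  by apply: eq_bigr => i _; rewrite b_lt sum1_card.
have Mle : (2 * #|E|)%:R <= \sum_i br i * d i.
  have -> : \sum_i br i * d i = (\sum_i b i * degree E (v i))%:R.
    by rewrite natr_sum; apply: eq_bigr => i _; rewrite natrM.
  rewrite ler_nat -sum_degree // (sum_greedy E x0 _ p) big_ord_recr /= b_max.
  apply: leq_add (sum_degree_rest E x0 p); apply: leq_sum => i _.
  by rewrite b_lt; apply: sum_degree_part.
have db i : i != ord_max -> d i <= N - br i.
  move=> ik; rewrite lerBrDr addrC -natrD ler_nat /b (negPf ik).
  exact: card_greedy_part.
have c2 : 2 <= #|'I_p.+1|%:R :> R by rewrite card_ord ler_nat.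
have N0 : 0 < N by rewrite ltr0n.
have rest0 : rest p != set0.
  rewrite -card_gt0 -b_max lt0n -(pnatr_eq0 R).
  by apply: (@last_part_neq0 _ _ _ br d N (2 * #|E|)%:R eta c2 N0) => //; rewrite card_ord.
apply: le_trans (_ : (\sum_i d i) * N <= _); last first.
  rewrite ler_wpM2r ?ler0n // /d -natr_sum ler_nat.
  exact: sum_greedy_le_Delta.
rewrite -[p.+1 in X in X <= _]card_ord.
apply: (@degree_sum_ge _ _ ord_max br) => //; rewrite ?card_ord //.
- by move=> i; rewrite ler_nat greedy_degree // leq_ord.
- by rewrite ler_nat; apply: max_card.
Qed.

Theorem theorem4 (R : realType) (r : nat) (hr : (2 <= r)%N) :
  forall eps : R, 0 < eps ->
  exists (n0 : nat) (delta : R), 0 < delta /\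
  forall n m : nat, (n0 < n)%N -> (m <= 'C(n, 2))%N ->
    (turan_number r n)%:R - delta * n%:R ^+ 2 < m%:R :> R ->
    (1 - eps) * ((2 * r * m)%:R / n%:R) < (Delta_min r n m)%:R :> R.
Proof.
move=> eps eps0; case: r hr => // p; rewrite ltnS => p0.
set c : R := p.+1%:R; have c2 : 2 <= c by rewrite ler_nat.
have c0 : 0 < c by apply: lt_le_trans c2.
(* The first bound meets the hypothesis of [Delta_ge]; the second makes 8 eta at most eps/2,
   strictly below eps. *)
pose eta : R := Num.min (1 / (4 * c ^+ 2)) (eps / 16).
have eta0 : 0 < eta by rewrite lt_min !divr_gt0 // mulr_gt0 ?exprn_gt0.
have etac : 4 * eta * c ^+ 2 <= 1.
  rewrite mulrAC -ler_pdivlMl ?mulr_gt0 ?exprn_gt0 //.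
  by rewrite -[_^-1]mul1r mulr1 ge_min lexx.
have eta_eps : eta <= eps / 16 by rewrite ge_min lexx orbT.
have eta16 : 16 * eta <= 1 by nra.
(* Doubling the edge count spends two thirds of [eta * N ^+ 2] on delta; the last third absorbs the
   rounding term N once N >= 3/eta. *)
exists (Num.bound (3 / eta)), (eta / 3); split; first by rewrite divr_gt0.
move=> n m n0 mle tm.
have n_gt0 : (0 < n)%N by apply: leq_ltn_trans n0.
pose N : R := n%:R; have N0 : 0 < N by rewrite ltr0n.
have Nbig : 1 <= eta / 3 * N.
  rewrite -ler_pdivrMl ?divr_gt0 // invf_div mulr1.
  apply: le_trans (ler_norm _) _; apply: (le_trans (ltW (archi_boundP _))).
    by rewrite normr_ge0.
  rewrite ler_nat; apply: leq_trans (ltnW n0).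
  by rewrite ger0_norm // divr_ge0 // ltW.
have [[E /andP[sE /eqP Em] <-] _] := Delta_minP p.+1 mle.
have N2 : N <= eta / 3 * N ^+ 2 by rewrite expr2 mulrA ler_peMl // ltW.
have N2c : N ^+ 2 / c <= N ^+ 2 / 2.
  by rewrite ler_pM2l ?exprn_gt0 // lef_pV2 ?posrE.
have turan : N ^+ 2 <= 2 * (turan_number p.+1 n)%:R + N ^+ 2 / c + N.
  have := turan_number_ge p.+1 n; rewrite -(ler_nat R) natrM natrD !natrM -/N.
  move/le_trans; apply; rewrite -addrA lerD2l -[(n %/ _).+1]addn1 natrD mulrDr mulr1.
  rewrite lerD2r expr2 -mulrA ler_pM2l // ler_pdivlMr // -natrM ler_nat.
  exact: leq_divM.
have M_ge : N ^+ 2 - N ^+ 2 / c - eta * N ^+ 2 <= 2 * m%:R.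
  move: tm turan N2; rewrite -/N mulrAC; move: (N ^+ 2 / c) (eta * N ^+ 2) => Q W; lra.
(* Positivity of m is what keeps the final inequality strict. *)
have m0 : 0 < m%:R :> R.
  have N2_gt0 : 0 < N ^+ 2 by rewrite exprn_gt0.
  have := ler_wpM2r (ltW N2_gt0) eta16; rewrite mul1r -mulrA.
  move: M_ge N2c; move: (N ^+ 2 / c) (eta * N ^+ 2) => Q W; lra.
have := @Delta_ge R _ E p eta sE p0; rewrite card_ord Em natrM.
move=> /(_ n_gt0 (ltW eta0) etac M_ge).
rewrite -/c -/N => Dge; rewrite mulrA ltr_pdivrMr //; apply: lt_le_trans Dge.
have cm0 : 0 < c * (2 * m%:R) by rewrite !mulr_gt0.
rewrite !natrM -/c (mulrC 2) -mulrA [ltRHS]mulrCA ltr_pM2r //.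
by move: eta_eps eps0; lra.
Qed.
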